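(* Let $b$ be a positive integer. A $b$-colored partition of $n$ into distinct parts is a finite set of colored parts $r_c$ ($r\ge1$, $c\in\{1,\dots,b\}$), each colored part occurring at most once (parts of equal size but different colors are considered distinct), whose sizes sum to $n$. Let $F^d_k(n)$ be the total number of parts of size $k$ (of any color) in all $b$-colored partitions of $n$ into distinct parts. Consider also $b$-colored partitions of $n$ into odd parts: finite multisets of colored parts $r_c$ with $r$ odd and $c\in\{1,\dots,b\}$ whose sizes (with multiplicity) sum to $n$; for such a partition $\pi$ let $g^o_k(\pi)$ be the number of distinct colored parts $r_c$ occurring at least $k$ times in $\pi$, and let $G^o_k(n)=\sum_\pi g^o_k(\pi)$ over all $b$-colored partitions $\pi$ of $n$ into odd parts, with $G^o_k(m)=0$ for $m\le0$. Then for all positive integers $n$ and all $k=1,2,3,\dots$, $$F^d_k(n)=G^o_k(n)-G^o_k(n-k).$$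
   Context: For example, with $b=2$, $3_1+3_2+5_2$ is a $2$-colored partition of $11$ into distinct parts, contributing $2$ to $F^d_3(11)$. *)

(* Defs.v *)
From mathcomp Require Import all_boot all_order all_algebra.
Set Implicit Arguments.
Unset Strict Implicit.
Unset Printing Implicit Defensive.

Import Order.TTheory GRing.Theory Num.Theory.

(* A colored part r_c is the pair (r, c), with the colors 1, ..., b numbered
   0, ..., b-1. In a partition of n every size is at most n, so bounding r by n
   loses nothing; the index r = 0 is not a part and is excluded below. *)
Definition colored_part (n b : nat) : finType := ('I_n.+1 * 'I_b)%type.

Definition part_size (n b : nat) (x : colored_part n b) : nat := x.1.

Definition is_distinct_partition (n b : nat) (P : {set colored_part n b}) : bool :=
  [forall x in P, 0 < part_size x] && (\sum_(x in P) part_size x == n).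

Definition Fd (b k n : nat) : nat :=
  \sum_(P : {set colored_part n b} | is_distinct_partition P)
    #|[set x in P | part_size x == k]|.

(* A multiset of colored parts is its multiplicity function. Sizes being
   positive, no multiplicity in a partition of n exceeds n. *)
Definition colored_multiset (n b : nat) : finType :=
  {ffun colored_part n b -> 'I_n.+1}.

Definition mult (n b : nat) (pi : colored_multiset n b) (x : colored_part n b) : nat :=
  pi x.

Definition is_odd_partition (n b : nat) (pi : colored_multiset n b) : bool :=
  [forall x, (0 < mult pi x) ==> odd (part_size x)]
    && (\sum_x mult pi x * part_size x == n).

Definition go (n b k : nat) (pi : colored_multiset n b) : nat :=
  #|[set x | k <= mult pi x]|.

Definition Go (b k : nat) (m : int) : nat :=
  if (0 < m)%R then
    \sum_(pi : colored_multiset `|m|%N b | is_odd_partition pi) go k pi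
  else 0.

(* Main.v *)
(* Let D = prod_{s >= 1} (1 + q^s)^b be the generating function of the
   partitions into distinct parts; by Euler it also counts those into odd parts.
   Marking a part of size k gives
     sum_n F_k(n) q^n = b q^k D / (1 + q^k),
   and marking a colored odd part r_c that occurs at least k times gives
     sum_n G_k(n) q^n = b (sum_{r odd} q^(r k)) D = b q^k D / (1 - q^(2 k)),
   so the first series is 1 - q^k times the second.

   Power series truncated after q^N are modelled by an element x of an arbitrary
   commutative ring with x^(N+1) = 0, where 1 - x^s is inverted by a finite
   geometric sum; coefficients are read off in Z[X]/(X^(N+1)). *)
Require Import Defs.
From mathcomp Require Import all_boot all_order all_algebra.
From mathcomp Require Import ring.

Set Implicit Arguments.
Unset Strict Implicit.
Unset Printing Implicit Defensive.

Import GRing.Theory Num.Theory.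

Local Open Scope ring_scope.

(** * Geometric sums of a nilpotent element *)

Lemma expr_nilp (A : comNzRingType) (x : A) (N m : nat) :
  x ^+ N = 0 -> (N <= m)%N -> x ^+ m = 0.
Proof. by move=> xN /subnK <-; rewrite exprD xN mulr0. Qed.

Lemma exprX_nilp (A : comNzRingType) (x : A) (N s : nat) :
  x ^+ N = 0 -> (0 < s)%N -> (x ^+ s) ^+ N = 0.
Proof. by move=> xN s0; rewrite -exprM (expr_nilp xN) // leq_pmull. Qed.

Lemma geom_inv (A : comNzRingType) (y : A) (N : nat) :
  y ^+ N = 0 -> (1 - y) * \sum_(j < N) y ^+ j = 1.
Proof. by move=> yN; rewrite -opprB mulNr -subrX1 yN sub0r opprK. Qed.

(** Multiplying the tail by 1 - y telescopes to y^k - y^N, and y^N vanishes; for k > N both sides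
    are 0. *)
Lemma geom_tail (A : comNzRingType) (y : A) (N k : nat) :
  y ^+ N = 0 ->
  \sum_(j < N | (k <= j)%N) y ^+ j = y ^+ k * \sum_(j < N) y ^+ j.
Proof.
move=> yN.
have tel M : (1 - y) * \sum_(j < M | (k <= j)%N) y ^+ j
    = if (k <= M)%N then y ^+ k - y ^+ M else 0.
  elim: M => [|M IH].
    by rewrite big_ord0 mulr0; case: k => [|k] //=; rewrite subrr.
  rewrite big_mkcond big_ord_recr -big_mkcond /= mulrDr IH.
  rewrite [(k <= M.+1)%N]leq_eqVlt ltnS orbC.
  case: leqP => [kM|Mk] /=; first by rewrite exprS mulrBl mul1r addrA subrK.
  by rewrite mulr0 addr0; case: eqP => // ->; rewrite subrr.
have -> : y ^+ k = (1 - y) * \sum_(j < N | (k <= j)%N) y ^+ j.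
  rewrite tel yN subr0; case: leqP => // /ltnW Nk.
  by rewrite (expr_nilp yN).
by rewrite mulrAC geom_inv // mul1r.
Qed.

Lemma geom_odd (A : comNzRingType) (y : A) (N : nat) :
  y ^+ N = 0 -> (1 - y ^+ 2) * \sum_(j < N | odd j) y ^+ j = y.
Proof.
move=> yN.
(* The exponent [M + ~~ odd M] is the least odd number that is at least M, the first one missing
   from the partial sum. *)
have tel M : (1 - y ^+ 2) * \sum_(j < M | odd j) y ^+ j
    = y - y ^+ (M + ~~ odd M).
  elim: M => [|M IH]; first by rewrite big_ord0 mulr0 subrr.
  rewrite big_mkcond big_ord_recr -big_mkcond /= mulrDr IH.
  case: (odd M) => /=; rewrite addn0 addn1.
    by rewrite mulrBl mul1r -exprD addrA subrK add2n.
  by rewrite mulr0 addr0.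
by rewrite tel (expr_nilp yN) ?subr0 // leq_addr.
Qed.

(** * Euler's identity, truncated *)

Definition distinct_prod (A : comNzRingType) (x : A) (N : nat) : A :=
  \prod_(1 <= s < N.+1) (1 + x ^+ s).

Lemma distinct_prod_trunc (A : comNzRingType) (x : A) (m n : nat) :
  x ^+ m.+1 = 0 -> (m <= n)%N -> distinct_prod x n = distinct_prod x m.
Proof.
move=> xm mn; rewrite /distinct_prod (@big_cat_nat _ _ _ m.+1) //=.
rewrite [X in _ * X]big_nat_cond [X in _ * X]big1 ?mulr1 // => i.
by case/andP => /andP[mi _] _; rewrite (expr_nilp xm) // addr0.
Qed.

Lemma prod_double (A : comNzRingType) (f : nat -> A) (N : nat) :
  \prod_(1 <= s < N.+1) f s.*2 =
  \prod_(1 <= s < N.*2.+1 | ~~ odd s) f s.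
Proof.
elim: N => [|N IH]; first by rewrite !big_geq.
rewrite big_nat_recr //= IH doubleS.
rewrite [in RHS]big_mkcond big_nat_recr // big_nat_recr //= odd_double /=.
by rewrite mulr1 -big_mkcond.
Qed.

(* Multiply prod_s (1 - x^s) by prod_s (1 + x^s): the result prod_s (1 - x^(2s))
   is the even half of prod_s (1 - x^s), which cancels. *)
Lemma euler_distinct_odd (A : comNzRingType) (x : A) (N : nat) :
  x ^+ N.+1 = 0 ->
  distinct_prod x N * \prod_(1 <= s < N.+1 | odd s) (1 - x ^+ s) = 1.
Proof.
move=> xN; pose f s := 1 - x ^+ s.
pose even_prod := \prod_(1 <= s < N.+1 | ~~ odd s) f s.
have split : even_prod =
    distinct_prod x N * (\prod_(1 <= s < N.+1 | odd s) f s * even_prod).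
  have <- : \prod_(1 <= s < N.+1) f s =
      \prod_(1 <= s < N.+1 | odd s) f s * even_prod by rewrite (bigID odd).
  rewrite /distinct_prod -big_split /even_prod /=; apply: esym.
  transitivity (\prod_(1 <= s < N.+1) f s.*2).
    by apply: eq_bigr => s _; rewrite /f -muln2 exprM; ring.
  (* The even factors with index above N equal 1, since their powers of x vanish. *)
  rewrite prod_double (@big_cat_nat _ _ _ N.+1) ?ltnS -?addnn ?leq_addr //=.
  rewrite [X in _ * X]big_nat_cond [X in _ * X]big1 ?mulr1 // => i.
  by case/andP => /andP[mi _] _; rewrite /f (expr_nilp xN) // subr0.
(* Cancelling in an arbitrary ring needs an explicit inverse; geometric sums supply it factor by
   factor. *)
pose inv := \prod_(1 <= s < N.+1 | ~~ odd s) \sum_(j < N.+1) (x ^+ s) ^+ j.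
have invP : even_prod * inv = 1.
  rewrite -big_split /= big_nat_cond big1 // => s /andP[/andP[s0 _] _].
  by rewrite geom_inv // exprX_nilp.
by rewrite -[RHS]invP split -!mulrA invP mulr1.
Qed.

(** Both sides are inverses of the product of 1 - x^s over odd s. *)
Lemma odd_prod (A : comNzRingType) (x : A) (N : nat) :
  x ^+ N.+1 = 0 ->
  \prod_(1 <= s < N.+1 | odd s) \sum_(j < N.+1) (x ^+ s) ^+ j
  = distinct_prod x N.
Proof.
move=> xN; set O := LHS.
have inv : \prod_(1 <= s < N.+1 | odd s) (1 - x ^+ s) * O = 1.
  rewrite -big_split /= big_nat_cond big1 // => s /andP[/andP[s0 _] _].
  by rewrite geom_inv // exprX_nilp.
by rewrite -[LHS]mul1r -(euler_distinct_odd xN) -mulrA inv mulr1.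
Qed.

(** * Generating functions over a finite type of weighted parts *)

Section Weighted.

Variables (A : comNzRingType) (x : A) (T : finType) (w : T -> nat).

Lemma sum_card_set (I : finType) (P : pred I) (E : I -> {set T}) (F : I -> A) :
  \sum_(i | P i) #|E i|%:R * F i
  = \sum_y \sum_(i | P i && (y \in E i)) F i.
Proof.
rewrite (exchange_big_dep P) /=; last by move=> y i _ /andP[].
apply: eq_bigr => i Pi; rewrite mulr_natl -sumr_const.
by apply: eq_bigl => y; rewrite Pi.
Qed.

(** Requiring y in P replaces its factor 1 + x^k by x^k; multiplying by 1 + x^k restores the full
    product. *)
Lemma marked_distinct_gf (y : T) (k : nat) : (0 < k)%N -> w y = k ->
  (1 + x ^+ k) *
  \sum_(P : {set T} | [forall z in P, 0 < w z]%N && (y \in P))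
     x ^+ (\sum_(z in P) w z)
  = x ^+ k * \prod_(z | (0 < w z)%N) (1 + x ^+ w z).
Proof.
move=> k0 wy.
(* When the product of [F z + G z] is expanded, P collects the z where [F] is chosen. The zeros of
   [F] forbid elements of weight 0, and [G y = 0] forces y into P. *)
pose F z := if (0 < w z)%N then x ^+ w z else 0.
pose G z : A := (z != y)%:R.
have -> : \sum_(P : {set T} | [forall z in P, 0 < w z]%N && (y \in P))
     x ^+ (\sum_(z in P) w z) = \prod_z (F z + G z).
  rewrite bigA_distr big_mkcond /=; apply: eq_bigr => P _.
  case: ifP => [/andP[/'forall_implyP posP yP]|].
    rewrite expr_sum [RHS](bigID (mem P)) /= [X in _ = _ * X]big1 => [|z /negPf zP].
      by rewrite mulr1; apply: eq_bigr => z zP; rewrite zP /F posP.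
    by rewrite zP /G; case: eqP zP yP => // -> ->.
  move=> /negbT; rewrite negb_and => /orP[|yP].
    case/forallPn => z; rewrite negb_imply => /andP[zP wz].
    by rewrite (bigD1 z) //= zP /F (negPf wz) mul0r.
  by rewrite (bigD1 y) //= (negPf yP) /G eqxx mul0r.
rewrite (bigD1 y) //= [in RHS](bigD1 y) ?wy //= /F /G wy k0 eqxx addr0.
rewrite mulrCA; congr (_ * (_ * _)).
rewrite [in RHS]big_mkcond [in LHS]big_mkcond; apply: eq_bigr => z _ /=.
case: (z =P y) => [->|_]; first by rewrite andbF.
by rewrite andbT; case: ifP => _; rewrite ?add0r // addrC.
Qed.

Lemma distinct_gf (k : nat) : (0 < k)%N ->
  (1 + x ^+ k) *
  \sum_(P : {set T} | [forall z in P, 0 < w z]%N)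
     #|[set z in P | w z == k]|%:R * x ^+ (\sum_(z in P) w z)
  = x ^+ k * \prod_(z | (0 < w z)%N) (1 + x ^+ w z) *+ #|[set z | w z == k]|.
Proof.
move=> k0; rewrite sum_card_set mulr_sumr -sumr_const [RHS]big_mkcond /=.
apply: eq_bigr => y _; rewrite inE; case: (w y =P k) => [wy|wy].
  rewrite -(marked_distinct_gf k0 wy); congr (_ * _).
  by apply: eq_bigl => P; rewrite inE wy eqxx andbT.
by rewrite big_pred0 ?mulr0 // => P; rewrite inE; case: eqP; rewrite ?andbF.
Qed.

(** Multiplicities are chosen independently, so the sum is a product over z. An unmarked odd weight
    gives a full geometric sum, an even one gives 1, and the mark at y leaves a geometric tail. *)
Lemma marked_odd_gf (N k : nat) (y : T) : x ^+ N.+1 = 0 -> (0 < k)%N ->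
  \sum_(pi : {ffun T -> 'I_N.+1} |
         [forall z, (0 < pi z) ==> odd (w z)]%N && (k <= pi y)%N)
     x ^+ (\sum_z pi z * w z)
  = (if odd (w y) then (x ^+ w y) ^+ k else 0)
    * \prod_(z | odd (w z)) \sum_(j < N.+1) (x ^+ w z) ^+ j.
Proof.
move=> xN k0.
pose Q z (j : 'I_N.+1) := ((0 < j) ==> odd (w z))%N && ((z == y) ==> (k <= j)%N).
transitivity (\prod_z \sum_(j < N.+1 | Q z j) (x ^+ w z) ^+ j).
  rewrite bigA_distr_big_dep; apply: eq_big => [pi|pi _].
    apply/andP/familyP => [[/forallP oddpi kpi] z|famP].
      by rewrite unfold_in /Q oddpi; apply/implyP => /eqP ->.
    split; last by have /andP[_] := famP y; rewrite eqxx.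
    by apply/forallP => z; have /andP[] := famP z.
  by rewrite expr_sum; apply: eq_bigr => z _; rewrite mulnC exprM.
transitivity (\prod_z (if z == y then
      if odd (w y) then (x ^+ w y) ^+ k else 0 else 1) *
    \prod_z (if odd (w z) then \sum_(j < N.+1) (x ^+ w z) ^+ j else 1)).
  rewrite -big_split; apply: eq_bigr => z _ /=.
  rewrite /Q; case: (z =P y) => [->|_]; case: ifP => oddz /=.
  - rewrite -geom_tail; last by rewrite exprX_nilp // odd_gt0.
    by apply: eq_bigl => j; rewrite implybT.
  (* For y of even weight the multiplicity must be 0, which contradicts k <= j because k is
     positive. *)
  - rewrite mul0r big_pred0 // => j; rewrite implybF.
    by rewrite -eqn0Ngt; case: eqP => [->|] //=; rewrite leqNgt k0.
  - by rewrite mul1r; apply: eq_bigl => j; rewrite implybT.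
  - rewrite mul1r (big_pred1 ord0) // => j.
    by rewrite implybF andbT -leqNgt leqn0.
by rewrite -[X in X * _]big_mkcond big_pred1_eq -[in LHS]big_mkcond.
Qed.

Lemma odd_gf (N k : nat) : x ^+ N.+1 = 0 -> (0 < k)%N ->
  \sum_(pi : {ffun T -> 'I_N.+1} | [forall z, (0 < pi z) ==> odd (w z)]%N)
     #|[set z | k <= pi z]%N|%:R * x ^+ (\sum_z pi z * w z)
  = (\sum_(z | odd (w z)) (x ^+ w z) ^+ k)
    * \prod_(z | odd (w z)) \sum_(j < N.+1) (x ^+ w z) ^+ j.
Proof.
move=> xN k0; rewrite sum_card_set mulr_suml [RHS]big_mkcond.
apply: eq_bigr => y _.
transitivity (\sum_(pi : {ffun T -> 'I_N.+1} |
    [forall z, (0 < pi z) ==> odd (w z)]%N && (k <= pi y)%N)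
      x ^+ (\sum_z pi z * w z)).
  by apply: eq_bigl => pi; rewrite inE.
by rewrite marked_odd_gf //; case: ifP => // _; rewrite mul0r.
Qed.

End Weighted.

(** * Specialization to colored parts *)

Section ColoredParts.

Variables (N b : nat).

Lemma prod_colored (A : comNzRingType) (P : pred nat) (f : nat -> A) :
  \prod_(y : colored_part N b | P (part_size y)) f (part_size y)
  = (\prod_(s < N.+1 | P s) f s) ^+ b.
Proof.
transitivity (\prod_(s < N.+1 | P s) \prod_(c < b) f s).
  by rewrite pair_big; apply: eq_bigl => y; rewrite andbT.
under eq_bigr do rewrite prodr_const card_ord.
by rewrite prodrXl.
Qed.

Lemma sum_colored (A : zmodType) (P : pred nat) (f : nat -> A) :
  \sum_(y : colored_part N b | P (part_size y)) f (part_size y)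
  = (\sum_(s < N.+1 | P s) f s) *+ b.
Proof.
transitivity (\sum_(s < N.+1 | P s) \sum_(c < b) f s).
  by rewrite pair_big; apply: eq_bigl => y; rewrite andbT.
under eq_bigr do rewrite sumr_const card_ord.
by rewrite sumrMnl.
Qed.

Lemma card_colored (k : nat) : (k <= N)%N ->
  #|[set y : colored_part N b | part_size y == k]| = b.
Proof.
move=> kN.
have -> : [set y : colored_part N b | part_size y == k]
    = setX [set inord k] [set: 'I_b].
  apply/setP => -[s c]; rewrite !inE andbT /part_size /=.
  by rewrite -val_eqE /= inordK.
by rewrite cardsX cards1 cardsT card_ord mul1n.
Qed.

End ColoredParts.

Lemma prod_ord_nat1 (A : comNzRingType) (P : pred nat) (f : nat -> A) (N : nat) :
  ~~ P 0 ->
  \prod_(s < N.+1 | P s) f s = \prod_(1 <= s < N.+1 | P s) f s.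
Proof.
move=> P0; rewrite -(big_mkord P f) big_mkcond big_nat_recl //= (negPf P0) mul1r.
by rewrite [RHS]big_mkcond big_add1.
Qed.

(* The truncation of b q^k D / (1 - q^(2 k)). *)
Definition Go_series (A : comNzRingType) (x : A) (b n k : nat) : A :=
  (x ^+ k * distinct_prod x n ^+ b * \sum_(j < n.+1) (x ^+ (2 * k)) ^+ j) *+ b.

(* The truncation order n of the series may exceed the one of x: this is what
   relates Go b k (n - k), which counts over 'I_(n - k).+1, to Fd b k n. *)
Lemma Go_seriesE (A : comNzRingType) (x : A) (b n m k : nat) :
  x ^+ m.+1 = 0 -> (m <= n)%N -> (0 < k)%N ->
  \sum_(pi : colored_multiset m b | [forall z, (0 < pi z)%N ==> odd (part_size z)])
     (go k pi)%:R * x ^+ (\sum_z pi z * part_size z)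
  = Go_series x b n k.
Proof.
move=> xm mn k0; rewrite (odd_gf _ xm k0).
rewrite (sum_colored m b odd (fun s => (x ^+ s) ^+ k)).
rewrite (prod_colored m b odd (fun s => \sum_(j < m.+1) (x ^+ s) ^+ j)).
rewrite (prod_ord_nat1 (P := odd) (fun s => \sum_(j < m.+1) (x ^+ s) ^+ j)) //.
rewrite odd_prod //.
rewrite /Go_series (distinct_prod_trunc xm mn) mulrnAl; congr (_ *+ b).
rewrite mulrAC; congr (_ * _).
under eq_bigr do rewrite exprAC.
have xkm : (x ^+ k) ^+ m.+1 = 0 by rewrite exprX_nilp.
have inv : (1 - x ^+ (2 * k)) * \sum_(j < n.+1) (x ^+ (2 * k)) ^+ j = 1.
  by rewrite geom_inv // exprX_nilp ?muln_gt0 // (expr_nilp xm).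
(* With y = x^k, the sum over odd s is y / (1 - y^2) by [geom_odd]. *)
by rewrite -[LHS]mul1r -inv mulrAC mulnC exprM geom_odd.
Qed.

(** As 1 - x^(2k) = (1 - x^k)(1 + x^k), dividing by 1 + x^k amounts to multiplying by 1 - x^k and by
    the geometric inverse of 1 - x^(2k). *)
Lemma Fd_seriesE (A : comNzRingType) (x : A) (b n k : nat) :
  x ^+ n.+1 = 0 -> (0 < k)%N ->
  \sum_(P : {set colored_part n b} | [forall z in P, 0 < part_size z]%N)
     #|[set z in P | part_size z == k]|%:R * x ^+ (\sum_(z in P) part_size z)
  = (1 - x ^+ k) * Go_series x b n k.
Proof.
move=> xn k0; set F := LHS.
have gf : (1 + x ^+ k) * F = (x ^+ k * distinct_prod x n ^+ b) *+ b.
  rewrite distinct_gf //.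
  rewrite (prod_colored n b (fun s => 0 < s)%N (fun s => 1 + x ^+ s)).
  rewrite (prod_ord_nat1 (P := fun s => 0 < s)%N (fun s => 1 + x ^+ s)) //.
  have -> : \prod_(1 <= s < n.+1 | (0 < s)%N) (1 + x ^+ s) = distinct_prod x n.
    rewrite /distinct_prod [LHS]big_nat_cond [RHS]big_nat_cond.
    by apply: eq_bigl => s; case: s; rewrite ?andbT.
  (* For k > n the number of parts of size k does not matter, because x^k = 0. *)
  have [/card_colored -> //|nk] := leqP k n.
  by rewrite (expr_nilp xn) // mul0r !mul0rn.
have inv : (1 - x ^+ (2 * k)) * \sum_(j < n.+1) (x ^+ (2 * k)) ^+ j = 1.
  by rewrite geom_inv // exprX_nilp ?muln_gt0.
rewrite /Go_series -mulrnAl -gf -[LHS]mul1r -[X in X * F]inv mulnC exprM.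
set S := \sum_(j < _) _; ring.
Qed.

(** * Reading off coefficients *)

Lemma qpoly_Xn_eq0 (m : nat) : in_qpoly ('X^(m.+1) : {poly int}) 'X ^+ m.+1 = 0.
Proof.
rewrite -rmorphXn; apply/val_inj; rewrite /= mk_monic_Xn.
by rewrite Pdiv.RingMonic.rmodpp ?monicXn.
Qed.

(** Reduction modulo X^(m+1) only truncates after X^m, so identities for nilpotent x determine the
    coefficient of index m. *)
Lemma coef_in_qpoly (m : nat) (p q : {poly int}) :
  in_qpoly 'X^(m.+1) p = in_qpoly 'X^(m.+1) q -> p`_m = q`_m.
Proof.
move=> /(congr1 val); rewrite /= mk_monic_Xn -!Pdiv.RingMonic.take_poly_rmodp.
by move=> /(congr1 (fun r : {poly int} => r`_m)); rewrite !coef_take_poly ltnSn.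
Qed.

Lemma rmorph_Go_series (A B : comNzRingType) (f : {rmorphism A -> B}) (x : A)
  (b n k : nat) : f (Go_series x b n k) = Go_series (f x) b n k.
Proof.
rewrite /Go_series /distinct_prod rmorphMn !rmorphM rmorph_sum !rmorphXn rmorph_prod.
congr (_ * _ ^+ b * _ *+ b); apply: eq_bigr => i _.
  by rewrite rmorphD rmorph1 rmorphXn.
by rewrite !rmorphXn.
Qed.

(** Extracting a coefficient restores the condition on the total size, which the generating sums
    leave free. *)
Lemma coef_weighted_sum (I : finType) (P : pred I) (c s : I -> nat) (m : nat) :
  (\sum_(i | P i) (c i)%:R * 'X^(s i) : {poly int})`_m
  = (\sum_(i | P i && (s i == m)) c i)%:Z.
Proof.
rewrite coef_sum -[RHS]/(Posz _) -natz natr_sum [RHS]big_mkcondr.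
apply: eq_bigr => i _; rewrite mulr_natl coefMn coefXn eq_sym.
by case: eqP; rewrite ?mul0rn.
Qed.

Lemma rmorph_weighted_sum (A B : comNzRingType) (f : {rmorphism A -> B}) (x : A)
  (I : finType) (P : pred I) (c s : I -> nat) :
  f (\sum_(i | P i) (c i)%:R * x ^+ s i)
  = \sum_(i | P i) (c i)%:R * f x ^+ s i.
Proof.
by rewrite rmorph_sum; apply: eq_bigr => i _; rewrite rmorphM rmorph_nat rmorphXn.
Qed.

(** Each positive m is treated in its own quotient Z[X]/(X^(m+1)), but the polynomial depends on n
    only, so the indices n and n - k refer to the same polynomial. *)
Lemma Go_coef (b n m k : nat) : (m <= n)%N -> (0 < k)%N ->
  (Go b k m%:Z)%:Z = (Go_series ('X : {poly int}) b n k)`_m.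
Proof.
(* At m = 0 the convention [Go = 0] agrees with the factor X^k, k > 0. *)
move=> mn k0; case: (posnP m) => [->|m0].
  by rewrite /Go_series coefMn -mulrA coefXnM k0 mul0rn.
rewrite /Go ltz_nat m0.
rewrite -(coef_weighted_sum _ (fun pi => go k pi) (fun pi => \sum_z pi z * part_size z)%N).
apply: coef_in_qpoly; rewrite rmorph_weighted_sum rmorph_Go_series.
by rewrite (Go_seriesE _ _ mn) // qpoly_Xn_eq0.
Qed.

Lemma Fd_coef (b n k : nat) : (0 < k)%N ->
  (Fd b k n)%:Z = ((1 - 'X^k) * Go_series ('X : {poly int}) b n k)`_n.
Proof.
move=> k0; rewrite /Fd.
rewrite -(coef_weighted_sum _ (fun P : {set colored_part n b} =>
  #|[set z in P | part_size z == k]|) (fun P => \sum_(z in P) part_size z)%N).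
apply: coef_in_qpoly; rewrite rmorph_weighted_sum rmorphM rmorphB rmorph1 rmorphXn.
by rewrite rmorph_Go_series Fd_seriesE // qpoly_Xn_eq0.
Qed.

Local Close Scope ring_scope.

Theorem theorem5 (b n k : nat) (hb : 0 < b) (hn : 0 < n) (hk : 0 < k) :
  ((Fd b k n)%:Z = (Go b k n%:Z)%:Z - (Go b k (n%:Z - k%:Z))%:Z)%R.
Proof.
rewrite Fd_coef // (Go_coef _ (leqnn n)) // mulrBl mul1r coefB; congr (_ - _)%R.
(* For n < k the shifted coefficient is 0, as is [Go] at the negative argument n - k. *)
rewrite coefXnM; case: ltnP => [nk|kn].
  by rewrite /Go subr_gt0 ltz_nat ltnNge ltnW.
by rewrite subzn // (Go_coef _ (leq_subr k n)).
Qed.
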